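(* The Garside elements of the Artin monoids $\mathcal{M}(G_2)$ and $\mathcal{M}(I_2(p))$ ($p\ge5$, $p\ne6$) are $$\Delta(G_2)=x_1x_2x_1x_2x_1x_2,\qquad \Delta(I_2(p))=\underbrace{x_1x_2x_1x_2\cdots}_{p\text{ factors}}.$$
   Context: $\mathcal{M}(I_2(p))$ is the monoid with two generators $x_1,x_2$ and the single relation $\underbrace{x_1x_2x_1\cdots}_{p}=\underbrace{x_2x_1x_2\cdots}_{p}$; $\mathcal{M}(G_2)$ is the monoid given by the same presentation with $p=6$. The notation $\alpha\mid_L\beta$ means $\beta=\alpha\rho$ for some element $\rho$. The Garside element $\Delta$ of such a monoid is the unique element such that $x_i\mid_L\Delta$ for all $i$, and whenever $x_i\mid_L\omega$ for all $i$ then $\Delta\mid_L\omega$. *)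

(* Defs.v *)
From HB Require Import structures.
From mathcomp Require Import all_boot.
From mathcomp Require Import boolp.

Set Implicit Arguments.
Unset Strict Implicit.
Unset Printing Implicit Defensive.

Local Open Scope group_scope.
Local Open Scope quotient_scope.

(* Monoids given by generators (a type T) and defining relations
   (pairs of words u, v with R u v): the quotient of the free monoid seq T
   by the congruence generated by R. *)
Section Presentation.
Variables (T : choiceType) (R : seq T -> seq T -> Prop).

Inductive congr_gen : seq T -> seq T -> Prop :=
| congr_rel s u v t : R u v -> congr_gen (s ++ u ++ t) (s ++ v ++ t)
| congr_refl u : congr_gen u u
| congr_sym u v : congr_gen u v -> congr_gen v u
| congr_trans v u w : congr_gen u v -> congr_gen v w -> congr_gen u w.

Definition congrb : rel (seq T) := fun u v => `[< congr_gen u v >].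

Lemma congrb_refl : reflexive congrb.
Proof. by move=> u; apply/asboolP; apply: congr_refl. Qed.

Lemma congrb_sym : symmetric congrb.
Proof.
by move=> u v; apply/asboolP/asboolP => H; apply: congr_sym.
Qed.

Lemma congrb_trans : transitive congrb.
Proof.
move=> v u w /asboolP uv /asboolP vw; apply/asboolP.
exact: congr_trans uv vw.
Qed.

Canonical congrb_equiv := EquivRel congrb congrb_refl congrb_sym congrb_trans.

Definition presented := {eq_quot congrb}.
HB.instance Definition _ := Choice.on presented.
HB.instance Definition _ := EqQuotient.on presented.

Lemma presented_eqP (u v : seq T) :
  \pi_presented u = \pi_presented v <-> congr_gen u v.
Proof.
split=> [/eqP|uv]; last by apply/eqP; rewrite piE; apply/asboolP.
by rewrite piE => /asboolP.
Qed.

Lemma congr_gen_cat u u' v v' :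
  congr_gen u u' -> congr_gen v v' -> congr_gen (u ++ v) (u' ++ v').
Proof.
move=> uu' vv'; apply: (congr_trans (v := u' ++ v)).
  elim: uu' => {u u'} [s u w t Ruw|u|u w _|u w z _ IH1 _].
  - by rewrite -!catA; apply: congr_rel.
  - exact: congr_refl.
  - exact: congr_sym.
  - exact: congr_trans.
elim: vv' => {v v'} [s v w t Rvw|v|v w _|v w z _ IH1 _].
- by rewrite !(catA u'); apply: congr_rel.
- exact: congr_refl.
- exact: congr_sym.
- exact: congr_trans.
Qed.

Definition presented_mul (a b : presented) : presented :=
  \pi_presented (repr a ++ repr b).

Lemma presented_mulE u v :
  presented_mul (\pi_presented u) (\pi_presented v) = \pi_presented (u ++ v).
Proof.
by apply/presented_eqP; apply: congr_gen_cat; apply/presented_eqP; rewrite reprK.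
Qed.

Definition presented_one : presented := \pi_presented [::].

Fact presented_mulA : associative presented_mul.
Proof.
elim/quotW=> u; elim/quotW=> v; elim/quotW=> w.
rewrite (presented_mulE v w) (presented_mulE u v).
by rewrite (presented_mulE u) (presented_mulE _ w) catA.
Qed.

Fact presented_mul1 : left_id presented_one presented_mul.
Proof. by elim/quotW=> u; rewrite (presented_mulE [::] u). Qed.

Fact presented_mulr1 : right_id presented_one presented_mul.
Proof. by elim/quotW=> u; rewrite (presented_mulE u [::]) cats0. Qed.

HB.instance Definition _ :=
  isMonoid.Build presented presented_mulA presented_mul1 presented_mulr1.

Definition presented_gen (i : T) : presented := \pi_presented [:: i].

End Presentation.

(* The word a b a b ... with n letters. *)
Definition alternating (T : Type) (a b : T) (n : nat) : seq T :=
  mkseq (fun k => if odd k then b else a) n.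

(* The generators x_1, x_2 are indexed by 0 and 1 in 'I_2. *)
Definition I2_rel (p : nat) (u v : seq 'I_2) : Prop :=
  u = alternating ord0 ord_max p /\ v = alternating ord_max ord0 p.

Definition artin_I2 (p : nat) : monoidType := presented (I2_rel p).

Definition I2_gen (p : nat) (i : 'I_2) : artin_I2 p :=
  presented_gen (I2_rel p) i.

Definition artin_G2 : monoidType := artin_I2 6.

Definition G2_gen (i : 'I_2) : artin_G2 := I2_gen 6 i.

Definition ldvd (M : monoidType) (a b : M) : Prop := exists r : M, b = a * r.

Definition left_lcm_of_gens (M : monoidType) (I : Type) (x : I -> M) (d : M)
    : Prop :=
  (forall i, ldvd (x i) d) /\
  (forall w, (forall i, ldvd (x i) w) -> ldvd d w).

Definition is_garside (M : monoidType) (I : Type) (x : I -> M) (d : M) : Prop :=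
  unique (left_lcm_of_gens x) d.

(* Main.v *)
Require Import Defs.
From mathcomp Require Import all_boot.

(** Why the theorem holds.  Let [Delta] be the class of the word
    [x1 x2 x1 ...] with [p] letters.  Both sides of the defining relation
    spell [Delta], one beginning with [x1] and the other with [x2], so both
    generators divide [Delta] on the left.

    Conversely, suppose that [w = x1 a = x2 b].  A word for [x1 a] is joined to
    a word for [x2 b] by a chain of elementary substitutions, and somewhere
    along this chain the first letter changes.  A substitution that changes the
    first letter must act at the very beginning of the word, so the word it acts
    on is a relator side followed by some word; hence [w] lies in [Delta M]
    ([congr_gen_ohead]).

    Uniqueness: two left lcms divide each other, and the relation is
    homogeneous, so word length is well defined on the monoid and the two
    quotients have length zero ([ldvd_anti]). *)

Set Implicit Arguments.
Unset Strict Implicit.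
Unset Printing Implicit Defensive.

Local Open Scope quotient_scope.
Local Open Scope group_scope.

Section PresentedMonoid.
Context {T : choiceType} {R : seq T -> seq T -> Prop}.
Implicit Types u v : seq T.

Lemma pi_cat u v :
  \pi_(presented R) (u ++ v) = \pi_(presented R) u * \pi_(presented R) v.
Proof. exact/esym/presented_mulE. Qed.

Lemma pi_mkseq (f : nat -> T) n :
  \pi_(presented R) (mkseq f n) = \prod_(k < n) presented_gen R (f k).
Proof.
elim: n => [|n IHn]; first by rewrite big_ord0.
by rewrite big_ord_recr /= -IHn -pi_cat cats1 mkseqS.
Qed.

(** An elementary substitution away from the beginning of a word keeps its
    first letter; one at the beginning exhibits a relator side as a prefix.  The
    left sides suffice in the conclusion, a right side being congruent to the
    corresponding left side. *)
Lemma congr_gen_ohead u v :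
  congr_gen R u v ->
  ohead u = ohead v \/
  exists l r t, R l r /\ congr_gen R u (l ++ t).
Proof.
elim=> {u v} [[|a s] l r t Rlr|u|u v uv IH|v u w uv IHuv _ IHvw].
- by right; exists l, r, t; split=> //; apply: congr_refl.
- by left.
- by left.
- case: IH => [-> | [l [r [t [Rlr ult]]]]]; [by left | right].
  by exists l, r, t; split=> //; apply: congr_trans (congr_sym uv) ult.
- case: IHuv => [-> | ]; last by right.
  case: IHvw => [-> | [l [r [t [Rlr vlt]]]]]; [by left | right].
  by exists l, r, t; split=> //; apply: congr_trans uv vlt.
Qed.

Hypothesis R_homogeneous : forall u v, R u v -> size u = size v.

Lemma congr_gen_size u v : congr_gen R u v -> size u = size v.
Proof.
by elim=> {u v} [s u v t /R_homogeneous uv|//|//|v u w _ -> _ ->//];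
  rewrite !size_cat uv.
Qed.

(** If [b = a r] and [a = b s] then [a = a r s], so the words for [r] and [s]
    have length zero. *)
Lemma ldvd_anti (a b : presented R) : ldvd a b -> ldvd b a -> a = b.
Proof.
move=> [r ->] [s]; elim/quotW: a => a; elim/quotW: r => r; elim/quotW: s => s.
rewrite -(pi_cat a r) -(pi_cat _ s) => /presented_eqP/congr_gen_size/eqP.
rewrite !size_cat -addnA -{1}[size a]addn0 eqn_add2l eq_sym addn_eq0.
by case/andP=> /nilP-> _; rewrite cats0.
Qed.

Lemma garside_of_lcm (I : Type) (x : I -> presented R) d :
  left_lcm_of_gens x d -> is_garside x d.
Proof.
by move=> [xd dmin]; split=> [|e [xe emin]]; [split | apply: ldvd_anti; auto].
Qed.

End PresentedMonoid.

Lemma I2_rel_size p u v : I2_rel p u v -> size u = size v.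
Proof. by case=> -> ->; rewrite !size_mkseq. Qed.

Lemma ldvd_alternating p (a b : 'I_2) : 0 < p ->
  ldvd (I2_gen p a) (\pi_(presented (I2_rel p)) (alternating a b p)).
Proof.
case: p => // p _; exists (\pi_(presented (I2_rel p.+1)) (behead (alternating a b p.+1))).
by rewrite /I2_gen /presented_gen -pi_cat.
Qed.

Lemma garside_I2 p : 0 < p ->
  is_garside (I2_gen p) (\prod_(k < p) I2_gen p (if odd k then ord_max else ord0)).
Proof.
move=> p_gt0; rewrite -(pi_mkseq (fun k => if odd k then _ else _)).
rewrite -/(alternating _ _ p); apply: garside_of_lcm; first exact: I2_rel_size.
split=> [i | w xw].
  have [->|->] : i = ord0 \/ i = ord_max.
    by case: i => [[|[|]]] // ?; [left | right]; apply: val_inj.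
    exact: ldvd_alternating.
  (* The braid relation respells the element with [ord_max] in front. *)
  have -> : \pi_(presented (I2_rel p)) (alternating ord0 ord_max p)
          = \pi_(presented (I2_rel p)) (alternating ord_max ord0 p).
    apply/presented_eqP; rewrite -[alternating ord0 _ _]cats0.
    by rewrite -[alternating ord_max _ _]cats0; apply: (congr_rel [::]).
  exact: ldvd_alternating.
have [[a wa] [b wb]] := (xw ord0, xw ord_max).
elim/quotW: a wa => a wa; elim/quotW: b wb => b wb.
move: wa wb; rewrite /I2_gen /presented_gen -!pi_cat => -> /presented_eqP.
case/congr_gen_ohead => // -[l [r [t [[-> _] /presented_eqP ->]]]].
by exists (\pi_(presented (I2_rel p)) t); rewrite -pi_cat.
Qed.

Theorem corollary4 :
  (let x1 := G2_gen ord0 in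
   let x2 := G2_gen ord_max in
   is_garside G2_gen (x1 * x2 * x1 * x2 * x1 * x2)) /\
  (forall p : nat, (5 <= p)%N -> p <> 6 ->
   let x1 := I2_gen p ord0 in
   let x2 := I2_gen p ord_max in
   is_garside (I2_gen p) (\prod_(k < p) (if odd k then x2 else x1))).
Proof.
split=> [x1 x2 | p p_ge5 _ x1 x2].
  by have := @garside_I2 6 isT; rewrite !big_ord_recr big_ord0 /= mul1g.
have := @garside_I2 p (ltn_trans _ p_ge5) => /(_ isT).
by under eq_bigr => k _ do rewrite (fun_if (I2_gen p)).
Qed.
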